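(* Let $\mathcal{F}$ be the folded component (with vertex set $\{0,1,\dots,\mathrm{ord}(\ell)-1\}$ and edges as specified in the context). For all $v\in V(\mathcal{F})$ such that $2\nmid v$, $$\mathrm{ecc}(v)=\begin{cases}\frac12(v+1) & \text{if } v\ge \frac12(\mathrm{ord}(\ell)-1),\\ \frac12(\mathrm{ord}(\ell)-v) & \text{if } v<\frac12(\mathrm{ord}(\ell)-1).\end{cases}$$
   Context: Let $p$ be a prime with $p\equiv 71$ or $119\pmod{120}$, let $\ell=2$, and let $\mathrm{ord}(\ell)$ be the order, in the ideal class group of $\mathbb{Q}(\sqrt{-p})$, of a prime ideal above $2$; it is an odd integer $\ge 3$. The folded component $\mathcal{F}$ (a component of the supersingular $2$-isogeny graph over $\mathbb{F}_p$ after identifying curves up to $\overline{\mathbb{F}_p}$-isomorphism, regarded as a simple undirected graph) is labelled so that $V(\mathcal{F})=\{0,1,\dots,\mathrm{ord}(\ell)-1\}$ and $$E(\mathcal{F})=\{\{2k-1,2k+1\}: 1\le k\le \tfrac12(\mathrm{ord}(\ell)-3)\}\cup\{\{2k+1,2k+2\}:0\le k\le \tfrac12(\mathrm{ord}(\ell)-3)\}\cup\{\{0,1\}\}.$$ The eccentricity $\mathrm{ecc}(v)$ is the maximum graph distance from $v$ to any vertex of $\mathcal{F}$. *)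

(* Defs.v *)
From mathcomp Require Import all_boot all_order all_algebra all_field.
Set Implicit Arguments.
Unset Strict Implicit.
Unset Printing Implicit Defensive.
Import Order.TTheory GRing.Theory Num.Theory.
Local Open Scope ring_scope.

(* The field Q(sqrt(-p)) is realised inside the algebraic
   numbers algC; its ideals are predicates on algC. *)

Definition Qsqrt_neg (p : nat) (z : algC) : Prop :=
  exists a b : rat, z = ratr a + ratr b * sqrtC (- p%:R).

Definition ring_of_integers (p : nat) (z : algC) : Prop :=
  Qsqrt_neg p z /\ z \in Aint.

Definition is_ideal (p : nat) (I : algC -> Prop) : Prop :=
  [/\ forall x, I x -> ring_of_integers p x,
      I 0,
      forall x y, I x -> I y -> I (x + y)
    & forall a x, ring_of_integers p a -> I x -> I (a * x)].

Definition is_prime_ideal (p : nat) (P : algC -> Prop) : Prop :=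
  [/\ is_ideal p P,
      ~ P 1
    & forall x y, ring_of_integers p x -> ring_of_integers p y ->
        P (x * y) -> P x \/ P y].

(* The ideal P lies above the rational prime l when it meets Z in l Z. *)
Definition lies_above (l : nat) (P : algC -> Prop) : Prop :=
  forall m : int, P m%:~R <-> (l %| m)%Z.

Definition ideal_mul (I J : algC -> Prop) (x : algC) : Prop :=
  exists s : seq (algC * algC),
    (forall ab, ab \in s -> I ab.1 /\ J ab.2) /\
    x = \sum_(ab <- s) ab.1 * ab.2.

Definition ideal_exp (p : nat) (I : algC -> Prop) (n : nat) : algC -> Prop :=
  iter n (ideal_mul I) (ring_of_integers p).

(* Nonzero ideals I and J have the same class when a I = b J for some nonzero
   integers a and b of the field. *)
Definition same_ideal_class (p : nat) (I J : algC -> Prop) : Prop :=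
  exists a b : algC,
    [/\ ring_of_integers p a, a != 0, ring_of_integers p b, b != 0
      & forall z, (exists2 x, I x & z = a * x) <-> (exists2 y, J y & z = b * y)].

(* The whole ring is the identity of the class group, and a product of classes
   is the class of the product. *)
Definition class_order (p : nat) (P : algC -> Prop) (n : nat) : Prop :=
  [/\ (0 < n)%N,
      same_ideal_class p (ideal_exp p P n) (ring_of_integers p)
    & forall m : nat, (0 < m < n)%N ->
        ~ same_ideal_class p (ideal_exp p P m) (ring_of_integers p)].

Local Open Scope nat_scope.

(* The least length of a walk from u to v.  A shortest walk has fewer than #|T|
   edges; find returns #|T| when no walk joins u to v. *)
Definition graph_dist (T : finType) (e : rel T) (u v : T) : nat :=
  find (fun k => [exists w : k.-tuple T, path e u w && (last u w == v)])
       (iota 0 #|T|).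

Definition ecc (T : finType) (e : rel T) (v : T) : nat :=
  \max_(w : T) graph_dist e v w.

(* Each unordered edge is listed once, as a pair; index_iota a b stops at
   b - 1.  For the odd n >= 3 that occur, the halving is exact. *)
Definition folded_edges (n : nat) : seq (nat * nat) :=
  [seq (2 * k - 1, 2 * k + 1) | k <- index_iota 1 ((n - 3)./2).+1] ++
  [seq (2 * k + 1, 2 * k + 2) | k <- index_iota 0 ((n - 3)./2).+1] ++
  [:: (0, 1)].

Definition folded_component (n : nat) : rel 'I_n :=
  fun u v => ((val u, val v) \in folded_edges n)
          || ((val v, val u) \in folded_edges n).
Arguments folded_component : clear implicits.

(* Main.v *)
(* The eccentricities are read off the shape of the graph once the order n of
   P is known to be odd (for even n >= 4 the listed edges leave vertex n - 1
   isolated).  Suppose n = 2 m and P^n = (alpha).  As 2 splits, P = (2, gamma)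
   with gamma + conj gamma = 1, so alpha has norm 2^n and is not divisible by 2.
   Writing alpha = (x + y sqrt(-p)) / 2 this means that x is odd and
   p y^2 = (2^(m+1) - x) (2^(m+1) + x) with coprime factors, so that one factor
   is a square b^2 and the other p a^2.  Then beta = (b +- a sqrt(-p)) / 2
   satisfies beta^2 = +- alpha, i.e. (P^m)^2 = (beta)^2.  For z in P^m,
   (z / beta)^2 is integral, hence so is z / beta; thus P^m = beta J for an
   ideal J with J^2 = (1), and P^m = (beta) contradicts the minimality of n. *)
Require Import Defs.
From mathcomp Require Import all_boot all_order all_algebra all_field.
From mathcomp Require Import zify ring.
Set Implicit Arguments.
Unset Strict Implicit.
Unset Printing Implicit Defensive.
Import Order.TTheory GRing.Theory Num.Theory.

(** * Eccentricities of the folded component *)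

Local Open Scope nat_scope.

Lemma graph_dist_le (T : finType) (e : rel T) (u : T) (w : seq T) :
  path e u w -> size w < #|T| -> graph_dist e u (last u w) <= size w.
Proof.
move=> ew sw; rewrite /graph_dist leqNgt; apply/negP => lt.
have := negbT (before_find 0 lt); rewrite nth_iota // add0n => /negP[].
by apply/existsP; exists (in_tuple w); rewrite ew /=.
Qed.

(** When no walk joins [u] to [v], the distance is the default [#|T|]; the hypothesis [d <= #|T|]
    covers that case, so connectedness need not be known. *)
Lemma graph_dist_ge (T : finType) (e : rel T) (u v : T) (d : nat) :
  d <= #|T| -> (forall w, path e u w -> last u w = v -> d <= size w) ->
  d <= graph_dist e u v.
Proof.
move=> dT H; rewrite /graph_dist; set p := fun k : nat => _.
case: (boolP (has p (iota 0 #|T|))) => hp; last by rewrite hasNfind // size_iota.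
have := nth_find 0 hp; have := hp; rewrite has_find size_iota => lt.
rewrite nth_iota // add0n => /existsP[w /andP[ew /eqP lw]].
by have := H w ew lw; rewrite size_tuple.
Qed.

(* The folded component is a caterpillar: the odd vertices [2 i + 1] form its
   spine, and the leaves [0] and [2 i + 2] hang off [1] and [2 i + 1].  Heights
   of neighbours differ by at most 1, and [0] and the largest vertex are the
   extremes, so height differences give the lower bounds on eccentricities. *)
Definition height (w : nat) : nat := w.+1./2 + ((0 < w) && ~~ odd w).

(** Only the shape of an edge is kept, not the range of its index, since this already bounds the
    change of height along it. *)
Lemma folded_edgesP (n : nat) (a b : nat) :
  (a, b) \in folded_edges n ->
  [\/ exists2 k, a = k.*2.+1 & b = k.*2.+3,
      exists2 k, a = k.*2.+1 & b = k.*2.+2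
    | a = 0 /\ b = 1].
Proof.
rewrite !mem_cat => /or3P[/mapP[k]|/mapP[k]|].
- rewrite mem_index_iota => k1 [-> ->].
  by apply: Or31; exists k.-1; lia.
- by move=> _ [-> ->]; apply: Or32; exists k; lia.
- by rewrite inE => /eqP[-> ->]; apply: Or33.
Qed.

Lemma folded_height (n : nat) (u v : 'I_n) :
  folded_component n u v ->
  height u <= (height v).+1 /\ height v <= (height u).+1.
Proof.
suff H a b : (a, b) \in folded_edges n ->
   height a <= (height b).+1 /\ height b <= (height a).+1.
  by case/orP => /H // [].
by rewrite /height => /folded_edgesP[[k -> ->]|[k -> ->]|[-> ->]]; lia.
Qed.

Lemma folded_path_height (n : nat) (u : 'I_n) (w : seq 'I_n) :
  path (folded_component n) u w ->
  height u <= height (last u w) + size w /\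
  height (last u w) <= height u + size w.
Proof.
elim: w u => [|a w IH] u /=; first by rewrite addn0.
by case/andP => /folded_height ? /IH; lia.
Qed.

Lemma folded_sym (n : nat) : symmetric (folded_component n).
Proof. by move=> u v; rewrite /folded_component orbC. Qed.

Lemma folded_spine (h : nat) (a b : 'I_h.*2.+1) (k : nat) :
  val a = k.*2.+1 -> val b = k.*2.+3 -> folded_component h.*2.+1 a b.
Proof.
move=> ak bk; have : val b < h.*2.+1 := ltn_ord b.
rewrite /folded_component ak bk => lt.
apply/orP; left; rewrite !mem_cat; apply/orP; left; apply/mapP.
(* The first family lists spine edges from index 1, as {2k - 1, 2k + 1}, hence the shift. *)
by exists k.+1; [rewrite mem_index_iota; lia|congr pair; lia].
Qed.

Lemma folded_leaf (h : nat) (a b : 'I_h.*2.+1) (k : nat) :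
  val a = k.*2.+1 -> val b = k.*2.+2 -> folded_component h.*2.+1 a b.
Proof.
move=> ak bk; have : val b < h.*2.+1 := ltn_ord b.
rewrite /folded_component ak bk => lt.
apply/orP; left; rewrite !mem_cat; apply/orP; right; apply/orP; left.
by apply/mapP; exists k; [rewrite mem_index_iota; lia|congr pair; lia].
Qed.

Lemma folded_root (n : nat) (a b : 'I_n) :
  val a = 1 -> val b = 0 -> folded_component n a b.
Proof.
by move=> a1 b0; rewrite /folded_component a1 b0 !mem_cat !inE eqxx !orbT.
Qed.

(** Both directions are built in one induction, because a target may lie on either side of the
    starting vertex. *)
Lemma folded_spine_walk (h : nat) (d i : nat) (a b : 'I_h.*2.+1) :
  a = i.*2.+1 :> nat -> b = (i + d).*2.+1 :> nat ->
  (exists w, [/\ path (folded_component h.*2.+1) a w, last a w = b & size w = d])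
  /\ exists w, [/\ path (folded_component h.*2.+1) b w, last b w = a & size w = d].
Proof.
elim: d b => [|d IH] b ai bi.
  have -> : b = a by apply: val_inj; rewrite /= ai bi addn0.
  by split; exists [::].
have lt : (i + d).*2.+1 < h.*2.+1 by have := ltn_ord b; lia.
have [[w [ew lw sw]] [w' [ew' lw' sw']]] := IH (Ordinal lt) ai erefl.
have ecb : folded_component h.*2.+1 (Ordinal lt) b.
  by apply: (@folded_spine _ _ _ (i + d)) => //; rewrite /= bi; lia.
split.
  by exists (rcons w b); rewrite rcons_path last_rcons size_rcons ew lw ecb sw.
by exists (Ordinal lt :: w'); rewrite /= folded_sym ecb ew' lw' sw'.
Qed.

(** The walk follows the spine from index [i] to some index j and then takes at most one leaf edge.
    As 0 <= j < h, its length is at most |i - j| + 1 <= max (i + 1, h - i). *)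
Lemma folded_walk (h i : nat) (v w : 'I_h.*2.+1) :
  v = i.*2.+1 :> nat ->
  exists s, [/\ path (folded_component h.*2.+1) v s, last v s = w
              & size s <= maxn i.+1 (h - i)].
Proof.
move=> vi; have vlt := ltn_ord v; have wlt := ltn_ord w.
have spine j (b : 'I_h.*2.+1) : b = j.*2.+1 :> nat ->
  exists s, [/\ path (folded_component h.*2.+1) v s, last v s = b
              & size s = maxn i j - minn i j].
  move=> bj; case: (leqP i j) => ij.
    have [|[s [? ? ?]] _] := @folded_spine_walk h (j - i) i v b vi.
      by rewrite bj; lia.
    by exists s; split=> //; lia.
  have [|_ [s [? ? ?]]] := @folded_spine_walk h (i - j) j b v bj.
    by rewrite vi; lia.
  by exists s; split=> //; lia.
have step j (b : 'I_h.*2.+1) : b = j.*2.+1 :> nat -> folded_component h.*2.+1 b w ->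
    j < h ->
  exists s, [/\ path (folded_component h.*2.+1) v s, last v s = w
              & size s <= maxn i.+1 (h - i)].
  move=> bj ebw jh; have [s [es ls ss]] := spine j b bj.
  exists (rcons s w); rewrite rcons_path last_rcons size_rcons es ls ebw.
  by split=> //; lia.
case: (boolP (odd w)) => ow.
  have [|s [? ? ?]] := spine w./2 w; first by move=> /=; lia.
  by exists s; split=> //; lia.
(* Among the even vertices, 0 is exceptional: it hangs off 1, while every other one hangs off its
   predecessor. *)
case: (posnP w) => w0.
  have lt1 : 1 < h.*2.+1 by lia.
  apply: (step 0 (Ordinal lt1)) => //; [exact: folded_root|by lia].
have lt : (w./2.-1).*2.+1 < h.*2.+1 by lia.
apply: (step (w./2.-1) (Ordinal lt)) => //; try lia.
by apply: (@folded_leaf _ _ _ w./2.-1) => //=; lia.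
Qed.

(** [folded_walk] gives the upper bound. For the lower one, [v] has height i + 1, while 0 has height
    0 and the last vertex 2h has height h + 1. *)
Lemma folded_ecc (h i : nat) (v : 'I_h.*2.+1) :
  v = i.*2.+1 :> nat -> ecc (folded_component h.*2.+1) v = maxn i.+1 (h - i).
Proof.
move=> vi; have ih : i < h by have := ltn_ord v; lia.
apply/eqP; rewrite eqn_leq; apply/andP; split.
  apply/bigmax_leqP => w _; have [s [es ls ss]] := folded_walk w vi.
  apply: (@leq_trans (size s)); [rewrite -ls graph_dist_le // card_ord|exact: ss].
  by rewrite (leq_ltn_trans ss) // gtn_max; apply/andP; split; lia.
have lower (b : 'I_h.*2.+1) d : d <= h.*2.+1 ->
    (d + height b <= height v \/ d + height v <= height b) ->
    d <= ecc (folded_component h.*2.+1) v.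
  move=> dh hb; rewrite (leq_trans _ (leq_bigmax b)) //.
  apply: graph_dist_ge => [|s es ls]; first by rewrite card_ord.
  have := folded_path_height es; rewrite ls /=.
  by change (size s) with (@size 'I_h.*2.+1 s); lia.
have hv : height v = i.+1 by rewrite vi /height; lia.
rewrite geq_max; apply/andP; split.
  by apply: (lower ord0); rewrite ?hv; [lia|left; rewrite addn0].
apply: (lower ord_max); rewrite ?hv; first lia.
have -> : height (@ord_max h.*2) = h.+1 by rewrite /height /=; lia.
by right; lia.
Qed.

(** With n = 2h + 1 and v = 2i + 1 the two branches are i + 1 and h - i, and the threshold h <= 2i +
    1 says exactly that i + 1 is the larger. *)
Lemma half_gap (R : realFieldType) (h i : nat) : i < h ->
  (((maxn i.+1 (h - i))%:R : R) =
    if ((h.*2.+1)%:R - 1) / 2%:R <= ((i.*2.+1)%:R : R)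
    then ((i.*2.+1)%:R + 1) / 2%:R
    else ((h.*2.+1)%:R - (i.*2.+1)%:R) / 2%:R)%R.
Proof.
move=> ih.
have E (k : nat) : (k.*2.+1%:R = 2%:R * k%:R + 1 :> R)%R.
  by rewrite -addn1 natrD -mul2n natrM.
have -> : (((h.*2.+1)%:R - 1) / 2%:R <= ((i.*2.+1)%:R : R))%R = (h <= i.*2.+1).
  by rewrite (E h) addrK mulrC mulKf ?pnatr_eq0 // ler_nat.
rewrite (E h) (E i); case: leqP => hi.
  have -> : maxn i.+1 (h - i) = i.+1 by lia.
  by rewrite -addn1 natrD; field.
have -> : maxn i.+1 (h - i) = h - i by lia.
by rewrite natrB 1?ltnW //; field.
Qed.

Lemma folded_ecc_rat (n : nat) (v : 'I_n) :
  odd n -> odd v ->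
  (((ecc (folded_component n) v)%:R : rat) =
    if (n%:R - 1) / 2%:R <= (v%:R : rat)
    then (v%:R + 1) / 2%:R
    else (n%:R - v%:R) / 2%:R)%R.
Proof.
move=> on ov; have nh : n = (n./2).*2.+1 by lia.
move: n./2 nh v ov => h nh; rewrite nh => v ov.
have vi : v = (v./2).*2.+1 :> nat by lia.
rewrite (folded_ecc vi); have := ltn_ord v.
by move: (v./2) vi => i -> ih; apply: half_gap; lia.
Qed.

(** * The equation x^2 + p y^2 = 2^(2 m + 2) *)

(** The square of gcd(a, y) divides y^2 = ab and is coprime to b, so it divides a. Conversely it is
    the gcd of a^2, ay and y^2 = ab, all multiples of a. *)
Lemma coprime_mul_square (a b y : nat) :
  coprime a b -> a * b = y ^ 2 -> a = gcdn a y ^ 2.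
Proof.
move=> cab aby; have g2 : gcdn a (y ^ 2) = a by apply/gcdn_idPl; rewrite -aby dvdn_mulr.
case: (posnP a) => [a0|a0].
  by move: aby; rewrite a0 mul0n => /esym/eqP; rewrite expn_eq0 => /andP[/eqP -> _].
apply/eqP; rewrite eqn_dvd; apply/andP; split; last first.
  have : gcdn a y ^ 2 %| a * b.
    by rewrite aby dvdn_exp2r // dvdn_gcdr.
  by rewrite Gauss_dvdl // coprimeXl // (coprime_dvdl (dvdn_gcdl _ _)).
have -> : gcdn a y ^ 2 = gcdn (gcdn (a * a) (a * y)) (gcdn (y * a) (y * y)).
  by rewrite -!muln_gcdr -muln_gcdl mulnn.
by rewrite !dvdn_gcd (mulnn y) -aby (dvdn_mull y (dvdnn a)) !dvdn_mulr.
Qed.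

(** The prime divides one of the factors; cancelling it leaves two coprime numbers whose product is
    y^2. *)
Lemma coprime_mul_prime_square (p a b y : nat) :
  prime p -> coprime a b -> a * b = p * y ^ 2 ->
  exists c d, c * d = y /\ (a = p * c ^ 2 /\ b = d ^ 2 \/ a = c ^ 2 /\ b = p * d ^ 2).
Proof.
move=> pp; have p0 := prime_gt0 pp.
have H a' b' : p %| a' -> coprime a' b' -> a' * b' = p * y ^ 2 ->
    exists c d, c * d = y /\ (a' = p * c ^ 2 /\ b' = d ^ 2).
  case/dvdnP => k ->; rewrite coprimeMl => /andP[ck _] E.
  have E' : k * b' = y ^ 2 by apply/eqP; rewrite -(eqn_pmul2l p0) -E; apply/eqP; ring.
  have ek := coprime_mul_square ck E'.
  have eb : b' = gcdn b' y ^ 2.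
    by apply: (@coprime_mul_square _ k); rewrite 1?coprime_sym // mulnC.
  exists (gcdn k y), (gcdn b' y); split; last by rewrite -ek -eb mulnC.
  by apply/eqP; rewrite -(eqn_exp2r _ _ (isT : 0 < 2)) expnMn -ek -eb E'.
move=> cab E; have : p %| a * b by rewrite E dvdn_mulr.
rewrite Euclid_dvdM // => /orP[pa|pb].
  by have [c [d [cd [-> ->]]]] := H a b pa cab E; exists c, d; split=> //; left.
have [||c [d [cd [-> ->]]]] := H b a pb; [by rewrite coprime_sym|by rewrite mulnC|].
by exists d, c; split; [rewrite mulnC|right].
Qed.

Local Open Scope ring_scope.

(** In coordinates, the conclusion says that (b + a sqrt(-p)) / 2 squares to (-1)^e (x + y sqrt(-p))
    / 2. The sign [e] records which of the factors Q - x, Q + x is p times a square. *)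
Lemma norm_form_square (p m : nat) (x y : int) :
  prime p -> ~~ (2 %| x)%Z ->
  x ^+ 2 + p%:Z * y ^+ 2 = 2 ^+ (m.+1).*2 -> y != 0 ->
  exists a b : int, exists2 e : bool,
     b ^+ 2 - p%:Z * a ^+ 2 = (-1) ^+ e * (2 * x) & a * b = (-1) ^+ e * y.
Proof.
move=> pp ox E y0; have p0 := prime_gt0 pp.
have py : 0 < p%:Z * y ^+ 2 by rewrite mulr_gt0 // exprn_even_gt0 //= y0.
set Q : int := 2 ^+ m.+1.
have Q0 : 0 < Q by rewrite exprn_gt0.
have E2 : (Q - x) * (Q + x) = p%:Z * y ^+ 2.
  have -> : (Q - x) * (Q + x) = Q ^+ 2 - x ^+ 2 by ring.
  by rewrite /Q -exprM muln2 -E; ring.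
(* Both the product of the factors and their sum 2Q are positive. *)
have A0 : 0 < Q - x by nia.
have B0 : 0 < Q + x by nia.
have eA : Q - x = `|(Q - x)%R|%N%:Z by lia.
have eB : Q + x = `|(Q + x)%R|%N%:Z by lia.
have EN : (`|(Q - x)%R| * `|(Q + x)%R| = p * `|y| ^ 2)%N.
  apply/eqP; rewrite -eqz_nat PoszM -eA -eB E2 PoszM; apply/eqP; congr (_ * _).
  by rewrite -!abszX; lia.
(* A common divisor divides the sum 2^(m+2), so it is a power of 2; were it even, x = (Q + x) - Q
   would be even. *)
have cop : coprime `|(Q - x)%R| `|(Q + x)%R|.
  rewrite /coprime; set g := gcdn _ _.
  have gA : (g%:Z %| Q - x)%Z by rewrite dvdzE absz_nat dvdn_gcdl.
  have gB : (g%:Z %| Q + x)%Z by rewrite dvdzE absz_nat dvdn_gcdr.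
  have : (g%:Z %| 2 ^+ m.+2)%Z.
    have -> : 2 ^+ m.+2 = (Q - x) + (Q + x) :> int by rewrite exprS -/Q; ring.
    by rewrite rpredD.
  rewrite dvdzE absz_nat abszX => /(dvdn_pfactor _ _ (isT : prime 2)) [k _ gk].
  case: k gk => [|k] gk; first by rewrite gk.
  case/negP: ox; have -> : x = (Q + x) - Q by ring.
  rewrite rpredB //; last by rewrite /Q exprS dvdz_mulr.
  by apply: dvdz_trans gB; rewrite gk expnS PoszM dvdz_mulr.
have [c [d [cd H]]] := coprime_mul_prime_square pp cop EN.
(* The factorisation only knows |y|; the sign of y, and that of [e], are absorbed into [a]. *)
have signed (s : int) (u w : nat) : (u * w = `|y|)%N -> `|s| = 1 ->
    exists2 a : int, a ^+ 2 = (u%:Z) ^+ 2 & a * w%:Z = s * y.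
  move=> uw s1; exists (Num.sg (s * y) * u%:Z).
    by rewrite exprMn sqr_sg; rewrite mulf_eq0 (negPf y0) orbF -normr_eq0 s1 mul1r.
  by rewrite -mulrA -PoszM uw abszE -[`|y|]mul1r -s1 -normrM -numEsg.
case: H => -[HA HB].
  have [a a2 ab] := signed 1 c d cd (normr1 _).
  exists a, d%:Z, false; last by rewrite expr0 ab.
  rewrite a2 expr0 mul1r; have -> : (2 * x) = (Q + x) - (Q - x) by ring.
  by rewrite eA eB HA HB PoszM -!mulnn !PoszM !expr2.
have [|a a2 ab] := signed (-1) d c _ (normrN1 _); first by rewrite mulnC.
exists a, c%:Z, true; last by rewrite expr1 ab.
rewrite a2 expr1; have -> : -1 * (2 * x) = (Q - x) - (Q + x) by ring.
by rewrite eA eB HA HB PoszM -!mulnn !PoszM !expr2.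
Qed.

(** * Arithmetic of Q(sqrt(-p)) *)

Lemma Aint_quadratic (z : algC) (t n : int) :
  z ^+ 2 = t%:~R * z - n%:~R -> z \in Aint.
Proof.
move=> E; pose q : {poly algC} := 'X^2 + (- t%:~R *: 'X + n%:~R%:P).
have sq : (size (- t%:~R *: 'X + n%:~R%:P : {poly algC})%R < size ('X^2 : {poly algC})%R)%N.
  rewrite size_polyXn ltnS (leq_trans (size_polyD _ _)) // geq_max.
  rewrite (leq_trans (size_scale_leq _ _)) ?size_polyX //.
  by rewrite (leq_trans (size_polyC_leq1 _)).
apply: (@root_monic_Aint q).
- by rewrite /root /q !hornerE /= E mulNr addrAC subrK subrr.
- by rewrite monicE lead_coefDl // lead_coefXn.
- change (q \is a polyOver Num.int_num_subdef); apply: rpredD; first exact: polyOverXn.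
  apply: rpredD; last by rewrite polyOverC intr_int.
  by apply: polyOverZ; [rewrite rpredN intr_int|exact: polyOverX].
Qed.

(** If q is the monic integral minimal polynomial of z^2, then z is a root of q(X^2). *)
Lemma Aint_sqr (z : algC) : z ^+ 2 \in Aint -> z \in Aint.
Proof.
move=> iz; apply: (@root_monic_Aint (minCpoly (z ^+ 2) \Po 'X^2)).
- by rewrite /root horner_comp hornerXn; exact: root_minCpoly.
- rewrite monicE lead_coef_comp ?size_polyXn // lead_coefXn expr1n mulr1.
  exact: minCpoly_monic.
- change ((minCpoly (z ^+ 2) \Po 'X^2) \is a polyOver Num.int_num_subdef).
  by apply: polyOver_comp; [exact: iz|exact: polyOverXn].
Qed.

(** The conjugate has the same square, so it is s or -s. If it is s, then s^2 = -p is a norm, hence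
    nonnegative, which forces p = 0 and s = 0. *)
Lemma sqrtC_neg_conj (p : nat) : (sqrtC (- p%:R) : algC)^* = - sqrtC (- p%:R).
Proof.
set s : algC := sqrtC _; have s2 : s ^+ 2 = - p%:R by rewrite sqrtCK.
have : (s^* ) ^+ 2 == s ^+ 2 by rewrite -rmorphXn s2 rmorphN rmorph_nat.
rewrite eqf_sqr => /orP[/eqP cs|/eqP //].
have : 0 <= s * s^* by exact: mul_conjC_ge0.
rewrite cs -expr2 s2 oppr_ge0 lern0 => /eqP p0.
by rewrite /s p0 mulr0n oppr0 sqrtC0 oppr0.
Qed.

Lemma sqrtC_neg_sqr (p : nat) : (sqrtC (- p%:R) : algC) ^+ 2 = - p%:R.
Proof. exact: sqrtCK. Qed.

Lemma Qsqrt_rat (p : nat) (a : rat) : Qsqrt_neg p (ratr a).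
Proof. by exists a, 0; rewrite rmorph0 mul0r addr0. Qed.

Lemma Qsqrt_add (p : nat) (x y : algC) :
  Qsqrt_neg p x -> Qsqrt_neg p y -> Qsqrt_neg p (x + y).
Proof.
move=> [a [b ->]] [c [d ->]]; exists (a + c), (b + d).
by rewrite !rmorphD /=; ring.
Qed.

Lemma Qsqrt_mul (p : nat) (x y : algC) :
  Qsqrt_neg p x -> Qsqrt_neg p y -> Qsqrt_neg p (x * y).
Proof.
move=> [a [b ->]] [c [d ->]]; exists (a * c - p%:R * b * d), (a * d + b * c).
rewrite !rmorphD rmorphN !rmorphM rmorph_nat /=.
by have := sqrtC_neg_sqr p; move: (sqrtC _) => s s2; ring: s2.
Qed.

Lemma conj_rat_sqrt (p : nat) (a b : rat) :
  (ratr a + ratr b * sqrtC (- p%:R) : algC)^* = ratr a - ratr b * sqrtC (- p%:R).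
Proof.
have := conj_Crat (Crat_rat a); have := conj_Crat (Crat_rat b).
move: (ratr a) (ratr b) => u v cv cu.
by rewrite rmorphD rmorphM /= sqrtC_neg_conj cu cv mulrN.
Qed.

Lemma Qsqrt_conj (p : nat) (x : algC) : Qsqrt_neg p x -> Qsqrt_neg p x^*.
Proof.
move=> [a [b ->]]; exists a, (- b).
by rewrite conj_rat_sqrt rmorphN mulNr.
Qed.

Lemma Qsqrt_norm (p : nat) (x : algC) : Qsqrt_neg p x -> x * x^* \in Crat.
Proof.
move=> [a [b ->]].
rewrite conj_rat_sqrt.
have -> : (ratr a + ratr b * sqrtC (- p%:R)) * (ratr a - ratr b * sqrtC (- p%:R)) =
   ratr (a ^+ 2 + p%:R * b ^+ 2) :> algC.
  rewrite rmorphD rmorphM !rmorphXn rmorph_nat /=.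
  by have := sqrtC_neg_sqr p; move: (sqrtC _) => s s2; ring: s2.
exact: Crat_rat.
Qed.

Lemma Qsqrt_div (p : nat) (x y : algC) :
  Qsqrt_neg p x -> Qsqrt_neg p y -> Qsqrt_neg p (x / y).
Proof.
move=> kx ky; rewrite invC_norm mulrCA normCK mulrC.
apply: Qsqrt_mul; first by apply: Qsqrt_mul => //; exact: Qsqrt_conj.
by have /rpredVr/CratP[a ->] := Qsqrt_norm ky; exact: Qsqrt_rat.
Qed.

Lemma integers_int (p : nat) (n : int) : ring_of_integers p n%:~R.
Proof.
split; last exact: Aint_int.
by rewrite -(rmorph_int (ratr : {rmorphism rat -> algC})); exact: Qsqrt_rat.
Qed.

Lemma integers_nat (p n : nat) : ring_of_integers p n%:R.
Proof. exact: (integers_int p n). Qed.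

Lemma integers_add (p : nat) (x y : algC) :
  ring_of_integers p x -> ring_of_integers p y -> ring_of_integers p (x + y).
Proof. by move=> [? ?] [? ?]; split; [exact: Qsqrt_add|exact: rpredD]. Qed.

Lemma integers_mul (p : nat) (x y : algC) :
  ring_of_integers p x -> ring_of_integers p y -> ring_of_integers p (x * y).
Proof. by move=> [? ?] [? ?]; split; [exact: Qsqrt_mul|exact: rpredM]. Qed.

Lemma integers_opp (p : nat) (x : algC) :
  ring_of_integers p x -> ring_of_integers p (- x).
Proof.
rewrite -mulN1r => ix; apply: integers_mul => //.
exact: (integers_int p (-1)).
Qed.

Lemma integers_exp (p n : nat) (x : algC) :
  ring_of_integers p x -> ring_of_integers p (x ^+ n).
Proof.
move=> ix; elim: n => [|n IH]; first exact: (integers_nat p 1).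
by rewrite exprS; exact: integers_mul.
Qed.

Lemma integers_conj (p : nat) (x : algC) :
  ring_of_integers p x -> ring_of_integers p x^*.
Proof. by move=> [? ?]; split; [exact: Qsqrt_conj|rewrite Aint_aut]. Qed.

Lemma integers_norm (p : nat) (x : algC) :
  ring_of_integers p x -> exists n : int, x * x^* = n%:~R.
Proof.
move=> ix; apply/intrP/Cint_rat_Aint; first by case: ix => /Qsqrt_norm.
by case: (integers_mul ix (integers_conj ix)).
Qed.

Lemma half_sum_integers (p : nat) (x y : int) :
  (p = 3 %[mod 4])%N -> (2 %| x - y)%Z ->
  ring_of_integers p ((x%:~R + y%:~R * sqrtC (- p%:R)) / 2%:R).
Proof.
move=> p3 /dvdzP[k xy].
have [j pj] : exists j : int, p%:Z = 4 * j + 3 by exists (p %/ 4)%N; lia.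
split.
  exists (x%:~R / 2%:R), (y%:~R / 2%:R).
  by rewrite !fmorph_div /= !rmorph_int rmorph_nat; ring.
have ex : x = y + k * 2 by rewrite -xy; ring.
(* Trace x and norm (x^2 + p y^2) / 4, the latter expanded with x = y + 2k and p = 4j + 3. *)
apply: (@Aint_quadratic _ x (k ^+ 2 + y * k + (j + 1) * y ^+ 2)).
have s2 := sqrtC_neg_sqr p; move: (sqrtC _) s2 => s s2.
have pj' : (p%:R : algC) = 4%:R * j%:~R + 3%:R.
  by rewrite -[LHS]/(p%:Z%:~R) pj rmorphD rmorphM.
rewrite pj' in s2; rewrite ex; by field: s2.
Qed.

Lemma prime_dvdz_sqr (p : nat) (x : int) : prime p -> (p %| x ^+ 2)%Z -> (p %| x)%Z.
Proof. by move=> pp; rewrite !dvdzE abszX Euclid_dvdX // => /andP[]. Qed.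

(** For z = a + b sqrt(-p), the trace x = 2a and t = 2pb are rational algebraic integers, hence
    integers. The norm n gives p x^2 + t^2 = 4pn, so p divides t and y = 2b is an integer. Parity
    follows from x^2 + p y^2 = 4n and p = 3 mod 4. *)
Lemma integers_half_sum (p : nat) (z : algC) :
  prime p -> (p = 3 %[mod 4])%N -> ring_of_integers p z ->
  exists x y : int,
    [/\ z = (x%:~R + y%:~R * sqrtC (- p%:R)) / 2%:R, (2 %| x - y)%Z &
        exists n : int, z * z^* = n%:~R /\ x ^+ 2 + p%:Z * y ^+ 2 = 4 * n].
Proof.
move=> pp p3 oz; have p0 := prime_gt0 pp; have zc := integers_conj oz.
have [n nz] := integers_norm oz.
case: (oz) => -[a [b zab]] iz; case: zc => _ izc.
have s2 := sqrtC_neg_sqr p; have cz := conj_rat_sqrt p a b; rewrite -zab in cz.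
have is_ : sqrtC (- p%:R) \in Aint.
  by apply: Aint_sqr; rewrite s2 rpredN; exact: (Aint_int p).
move: (sqrtC _) s2 is_ zab cz => s s2 is_ zab cz.
have [x ex] : exists x : int, 2%:R * ratr a = x%:~R :> algC.
  apply/intrP/Cint_rat_Aint; first by rewrite rpredM ?rpred_nat ?Crat_rat.
  have -> : 2%:R * ratr a = z + z^* by rewrite cz zab; ring.
  exact: rpredD.
have [t et] : exists t : int, 2%:R * p%:R * ratr b = t%:~R :> algC.
  apply/intrP/Cint_rat_Aint; first by apply: rpredM; [rewrite rpredM ?rpred_nat|exact: Crat_rat].
  have -> : 2%:R * p%:R * ratr b = - ((z - z^*) * s) by rewrite cz zab; ring: s2.
  by rewrite rpredN rpredM // rpredB.
have E1 : p%:Z * x ^+ 2 + t ^+ 2 = 4 * p%:Z * n.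
  apply: (@intr_inj algC); rewrite !(rmorphD, rmorphM, rmorphXn) /=.
  by rewrite -nz cz zab -ex -et; ring: s2.
have /dvdzP[y ty] : (p %| t)%Z.
  apply: prime_dvdz_sqr => //.
  have -> : t ^+ 2 = p%:Z * (4 * n - x ^+ 2).
    by rewrite mulrBr mulrCA mulrA -E1; ring.
  by rewrite dvdz_mulr.
have pz : (p%:R : algC) != 0 by rewrite pnatr_eq0 -lt0n.
have ey : 2%:R * ratr b = y%:~R :> algC.
  apply: (mulfI pz); rewrite mulrCA mulrA et ty rmorphM /= mulrC.
  by [].
have E2 : x ^+ 2 + p%:Z * y ^+ 2 = 4 * n.
  have pz' : p%:Z != 0 by lia.
  by apply: (mulfI pz'); rewrite mulrDr [RHS]mulrCA [RHS]mulrA -E1 ty; ring.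
exists x, y; split; last by exists n.
  by rewrite zab -ex -ey; field.
apply: prime_dvdz_sqr => //.
have [j pj] : exists j : int, p%:Z = 4 * j + 3 by exists (p %/ 4)%N; lia.
apply/dvdzP; exists (2 * n - (2 * j + 1) * y ^+ 2 - x * y).
have -> : (x - y) ^+ 2 = 4 * n - (p%:Z - 1) * y ^+ 2 - 2 * (x * y) by rewrite -E2; ring.
by rewrite pj; ring.
Qed.

(** * Ideals *)

Lemma ideal_sum (p : nat) (I : algC -> Prop) (T : eqType) (s : seq T) (F : T -> algC) :
  is_ideal p I -> (forall t, t \in s -> I (F t)) -> I (\sum_(t <- s) F t).
Proof.
case=> _ I0 ID _ IF; rewrite big_seq.
by elim/big_rec: _ => // t x ts; apply: ID; exact: IF.
Qed.

Lemma ideal_mul_prod (I J : algC -> Prop) (x y : algC) :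
  I x -> J y -> ideal_mul I J (x * y).
Proof.
move=> Ix Jy; exists [:: (x, y)]; split; last by rewrite big_seq1.
by move=> ab; rewrite inE => /eqP ->.
Qed.

Lemma ideal_mul_ideal (p : nat) (I J : algC -> Prop) :
  is_ideal p I -> is_ideal p J -> is_ideal p (ideal_mul I J).
Proof.
move=> [IO I0 ID IM] [JO J0 JD JM]; split.
- move=> _ [s [sIJ ->]]; rewrite big_seq.
  elim/big_rec: _ => [|ab x /sIJ[Ia Jb] ox]; first exact: (integers_nat p 0).
  by apply: integers_add => //; apply: integers_mul; [exact: IO|exact: JO].
- by exists [::]; rewrite big_nil.
- move=> _ _ [s [sIJ ->]] [t [tIJ ->]]; exists (s ++ t); rewrite big_cat; split=> //.
  by move=> ab; rewrite mem_cat => /orP[/sIJ|/tIJ].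
- move=> a _ oa [s [sIJ ->]]; exists [seq (a * ab.1, ab.2) | ab <- s]; split.
    by move=> _ /mapP[ab /sIJ[Ia Jb] ->]; split=> //; exact: IM.
  by rewrite big_map mulr_sumr; apply: eq_bigr => ab _; rewrite mulrA.
Qed.

Lemma integers_ideal (p : nat) : is_ideal p (ring_of_integers p).
Proof.
split=> //; first exact: (integers_nat p 0).
  exact: integers_add.
exact: integers_mul.
Qed.

Lemma ideal_exp_ideal (p n : nat) (I : algC -> Prop) :
  is_ideal p I -> is_ideal p (ideal_exp p I n).
Proof.
move=> idI; elim: n => [|n IH]; first exact: integers_ideal.
exact: ideal_mul_ideal.
Qed.

Lemma ideal_exp_pow (p n : nat) (I : algC -> Prop) (x : algC) :
  I x -> ideal_exp p I n (x ^+ n).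
Proof.
move=> Ix; elim: n => [|n IH]; first exact: (integers_nat p 1).
by rewrite exprS; exact: ideal_mul_prod.
Qed.

Lemma ideal_expD (p m n : nat) (I : algC -> Prop) (x y : algC) :
  is_ideal p I -> ideal_exp p I m x -> ideal_exp p I n y ->
  ideal_exp p I (m + n) (x * y).
Proof.
move=> idI; elim: m x => [|m IH] x /=.
  by move=> ox Jy; case: (ideal_exp_ideal n idI) => _ _ _; apply.
move=> [s [sI ->]] Jy; rewrite mulr_suml.
apply: (ideal_sum (ideal_exp_ideal (m.+1 + n) idI)) => ab /sI[Ia Jb].
by rewrite -mulrA; apply: ideal_mul_prod => //; exact: IH.
Qed.

(** The inclusion of I^(m+n) in I^m I^n, phrased as an induction principle for additive
    predicates. *)
Lemma ideal_expD_ind (p m n : nat) (I Q : algC -> Prop) :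
  is_ideal p I -> Q 0 -> (forall x y, Q x -> Q y -> Q (x + y)) ->
  (forall x y, ideal_exp p I m x -> ideal_exp p I n y -> Q (x * y)) ->
  forall z, ideal_exp p I (m + n) z -> Q z.
Proof.
move=> idI; elim: m Q => [|m IH] Q Q0 QD QM z.
  by move=> Jz; rewrite -[z]mul1r; apply: QM => //; exact: (integers_nat p 1).
move=> [s [sI ->]]; rewrite big_seq.
elim/big_rec: _ => // ab x /sI[Ia Jb]; apply: (QD).
apply: (IH (fun c => Q (ab.1 * c))) Jb => [|u w Qu Qw|u w Ju Jw].
- by rewrite mulr0.
- by rewrite mulrDr; exact: QD.
- by rewrite mulrA; apply: QM => //; exact: ideal_mul_prod.
Qed.

(** From a I = b O, the element b = b * 1 lies in a I, so b = a * al with [al] in I; cancelling a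
    shows that [al] generates I. *)
Lemma principal_of_same_class (p : nat) (I : algC -> Prop) :
  is_ideal p I -> same_ideal_class p I (ring_of_integers p) ->
  exists al, [/\ ring_of_integers p al, al != 0 &
    forall z, I z <-> exists2 w, ring_of_integers p w & z = al * w].
Proof.
move=> [IO _ _ IM] [a [b [oa a0 ob b0 E]]].
have [] : exists2 x, I x & b = a * x.
  by apply/E; exists 1; [exact: (integers_nat p 1)|rewrite mulr1].
move=> al Ial eb; exists al; split; first exact: IO.
  by apply: contraNneq b0 => al0; rewrite eb al0 mulr0.
move=> z; split=> [Iz|[w ow ->]]; last by rewrite mulrC; exact: IM.
have [|w ow] := (E (a * z)).1; first by exists z.
by rewrite eb -mulrA => /(mulfI a0) ->; exists w.
Qed.

(* [gamma] is the one of [(1 + sqrt (-p)) / 2] and its conjugate lying in [P]. *)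
Lemma prime_above2_generator (p : nat) (P : algC -> Prop) :
  prime p -> (p = 7 %[mod 8])%N -> is_prime_ideal p P -> lies_above 2 P ->
  exists (g : algC) (k : int),
    [/\ ring_of_integers p g, g * (1 - g) = 2%:R * k%:~R, g^* = 1 - g, P g &
      forall z, P z -> exists a b : int, z = 2%:R * a%:~R + b%:~R * g].
Proof.
move=> pp p7 [[PO P0 PD PM] _ Pprime] P2.
have p3 : (p = 3 %[mod 4])%N by lia.
(* As p = 7 mod 8, the norm (1 + p) / 4 of w = (1 + sqrt(-p)) / 2 is the even number 2k; hence the
   prime P contains w or its conjugate 1 - w. *)
have [k pk] : exists k : int, p%:Z = 8 * k - 1 by exists (p %/ 8).+1%:Z; lia.
have pkC : (p%:R : algC) = 8%:R * k%:~R - 1.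
  by rewrite -[LHS]/(p%:Z%:~R) pk rmorphB rmorphM.
pose s : algC := sqrtC (- p%:R); have s2 : s ^+ 2 = - p%:R := sqrtC_neg_sqr p.
have cs : s^* = - s := sqrtC_neg_conj p.
pose w := (1 + s) / 2%:R.
have ow : ring_of_integers p w by have := @half_sum_integers p 1 1 p3 isT; rewrite mul1r.
have cw : w^* = 1 - w.
  by rewrite /w rmorphM fmorphV rmorphD rmorph1 rmorph_nat /= cs; field.
have ww : w * (1 - w) = 2%:R * k%:~R by rewrite /w; rewrite pkC in s2; field: s2.
have oz z : P z -> exists x y : int, z = x%:~R + y%:~R * w.
  move=> /PO /(integers_half_sum pp p3)[x [y [-> /dvdzP[c xy] _]]].
  exists c, y; have -> : x = c * 2 + y by rewrite -xy; ring.
  by rewrite /w -/s; field.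
(* Subtracting the multiple of g leaves a rational integer in P, and P meets the integers in the
   even ones. *)
have even (g : algC) (a b : int) : P g -> P (a%:~R + b%:~R * g) ->
    exists a', a = 2 * a'.
  move=> Pg Pab; have Pa : P a%:~R.
    have -> : a%:~R = (a%:~R + b%:~R * g) + (- b)%:~R * g by rewrite rmorphN /=; ring.
    by apply: PD => //; apply: PM => //; exact: integers_int.
  by have /dvdzP[a' ->] := (P2 a).1 Pa; exists a'; rewrite mulrC.
have ocw : ring_of_integers p (1 - w) by rewrite -cw; exact: integers_conj.
have P2' : P 2%:R by apply/(P2 2).
have [Pw|Pw] : P w \/ P (1 - w).
- by apply: Pprime => //; rewrite ww mulrC; apply: PM => //; exact: integers_int.
- exists w, k; split=> // z Pz; have [x [y ez]] := oz z Pz.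
  have [|a ea] := even w x y Pw; first by rewrite -ez.
  by exists a, y; rewrite ez ea rmorphM.
- exists (1 - w), k; split=> //.
  + by rewrite -ww; ring.
  + by rewrite rmorphB rmorph1 /= cw.
  + move=> z Pz; have [x [y ez]] := oz z Pz.
    have ez' : z = (x + y)%:~R + (- y)%:~R * (1 - w).
      by rewrite ez rmorphD rmorphN /=; ring.
    have [|a ea] := even (1 - w) (x + y) (- y) Pw; first by rewrite -ez'.
    by exists a, (- y); rewrite ez' ea rmorphM.
Qed.

(* Elementwise form of [P * conj P = (2)]. *)
Lemma ideal_exp_mul_conj (p n : nat) (P : algC -> Prop) (g : algC) (k : int) :
  ring_of_integers p g -> g * (1 - g) = 2%:R * k%:~R -> g^* = 1 - g ->
  (forall z, P z -> exists a b : int, z = 2%:R * a%:~R + b%:~R * g) ->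
  forall x y, ideal_exp p P n x -> ideal_exp p P n y ->
  exists2 w, ring_of_integers p w & x * y^* = 2%:R ^+ n * w.
Proof.
move=> og gg cg gen; have ocg := integers_conj og; rewrite cg in ocg.
elim: n => [|n IH] x y.
  by move=> ox oy; exists (x * y^*); [apply: integers_mul => //; exact: integers_conj|rewrite mul1r].
have div0 m : exists2 w, ring_of_integers p w & 0 = 2%:R ^+ m * w.
  by exists 0; [exact: (integers_nat p 0)|rewrite mulr0].
have divD m u v : (exists2 w, ring_of_integers p w & u = 2%:R ^+ m * w) ->
  (exists2 w, ring_of_integers p w & v = 2%:R ^+ m * w) ->
  exists2 w, ring_of_integers p w & u + v = 2%:R ^+ m * w.
  move=> [w ow ->] [w' ow' ->]; exists (w + w'); first exact: integers_add.
  by rewrite mulrDr.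
move=> [s [sP ->]] [t [tP ->]]; rewrite rmorph_sum mulr_suml big_seq.
elim/big_rec: _ => // ab u /sP[Pa Jb]; apply: (divD).
rewrite mulr_sumr big_seq; elim/big_rec: _ => // cd v /tP[Pc Jd]; apply: (divD).
have [w ow ew] := IH _ _ Jb Jd.
have [a1 [b1 e1]] := gen _ Pa; have [a2 [b2 e2]] := gen _ Pc.
(* Half of (2 a1 + b1 g)(2 a2 + b2 (1 - g)), using g (1 - g) = 2k, times the cofactor from the
   induction hypothesis. *)
exists ((2%:R * a1%:~R * a2%:~R + a1%:~R * b2%:~R * (1 - g)
  + b1%:~R * a2%:~R * g + b1%:~R * b2%:~R * k%:~R) * w).
  have oi := integers_int p; have o2 := integers_nat p 2.
  by repeat first [exact: oi | exact: o2 | exact: og | exact: ocg | exact: ow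
                  | apply: integers_add | apply: integers_mul].
have cc : cd.1^* = 2%:R * a2%:~R + b2%:~R * (1 - g).
  by rewrite e2 rmorphD !rmorphM /= cg !rmorph_int rmorph_nat.
have g2 : g ^+ 2 = g - 2%:R * k%:~R by rewrite -gg; ring.
rewrite rmorphM /= mulrACA ew exprS e1 cc; move: (2%:R ^+ n) => q.
by ring: g2.
Qed.

(** * Generators of principal powers of [P], and oddness of the order *)

Lemma half_not_Aint : (2%:R^-1 : algC) \notin Aint.
Proof.
apply/negP => h; have /intrP[n en] : (2%:R^-1 : algC) \is a Num.int.
  by apply: Cint_rat_Aint h; rewrite rpredV rpred_nat.
have : (2 * n)%:~R = 1%:~R :> algC by rewrite rmorphM /= -en divff ?pnatr_eq0.
by move/intr_inj; lia.
Qed.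

(** Modulo 2, g^2 = g and so g^n = g. If g were 2u with u integral, the trace of u would be half the
    trace 1 of g, but 1/2 is not integral. *)
Lemma generator_pow_odd (p n : nat) (g : algC) (k : int) :
  ring_of_integers p g -> g * (1 - g) = 2%:R * k%:~R -> g^* = 1 - g ->
  (0 < n)%N -> ~ exists2 w, ring_of_integers p w & g ^+ n = 2%:R * w.
Proof.
move=> og gg cg n0 [w ow ew].
have [u ou eu] : exists2 u, ring_of_integers p u & g = 2%:R * u.
  have g2 : g ^+ 2 = g - 2%:R * k%:~R by rewrite -gg; ring.
  have [u ou eu] : exists2 u, ring_of_integers p u & g ^+ n = g + 2%:R * u.
    case: n n0 {ew} => // n _; elim: n => [|n [u ou IH]].
      by exists 0; [exact: (integers_nat p 0)|rewrite expr1 mulr0 addr0].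
    exists (g * u - k%:~R).
      apply: integers_add; first exact: integers_mul.
      by apply: integers_opp; exact: integers_int.
    by rewrite exprS IH; ring: g2.
  exists (w - u); first by apply: integers_add => //; exact: integers_opp.
  by rewrite mulrBr -ew eu addrK.
case: (integers_add ou (integers_conj ou)) => _.
have -> : u + u^* = 2%:R^-1; last by apply/negP; exact: half_not_Aint.
have cu : g^* = 2%:R * u^* by rewrite eu rmorphM /= rmorph_nat.
have -> : 2%:R^-1 = 2%:R^-1 * (2%:R * (u + u^*)) by rewrite mulrDr -eu -cu cg; field.
by rewrite mulKf ?pnatr_eq0.
Qed.

(** [al] divides g^n, which is not divisible by 2. Its norm is 2^n v with v an integer, and 2^n = al
    d. Taking norms, v N(d) = 2^n, so v is a power of 2; since conj al = v d, an even v would make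
    [al] divisible by 2. Hence v = 1. *)
Lemma principal_power_norm (p n : nat) (P : algC -> Prop) (g al : algC) (k : int) :
  is_ideal p P ->
  ring_of_integers p g -> g * (1 - g) = 2%:R * k%:~R -> g^* = 1 - g -> P g -> P 2%:R ->
  (forall z, P z -> exists a b : int, z = 2%:R * a%:~R + b%:~R * g) ->
  (0 < n)%N -> ring_of_integers p al ->
  (forall z, ideal_exp p P n z <-> exists2 w, ring_of_integers p w & z = al * w) ->
  al * al^* = 2%:R ^+ n /\ ~ exists2 w, ring_of_integers p w & al = 2%:R * w.
Proof.
move=> idP og gg cg Pg P2 gen n0 oal alE.
have al2 : ~ exists2 w, ring_of_integers p w & al = 2%:R * w.
  move=> [w ow ew]; have [e oe ge] := (alE _).1 (ideal_exp_pow p n Pg).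
  apply: (generator_pow_odd og gg cg n0); exists (w * e); first exact: integers_mul.
  by rewrite ge ew mulrA.
split=> //.
have Ial : ideal_exp p P n al.
  by apply/alE; exists 1; [exact: (integers_nat p 1)|rewrite mulr1].
have [u ou eu] := ideal_exp_mul_conj og gg cg gen Ial Ial.
have [d od ed] := (alE _).1 (ideal_exp_pow p n P2).
have q0 : (2%:R ^+ n : algC) != 0 by rewrite expf_neq0 ?pnatr_eq0.
have qc : (2%:R ^+ n : algC)^* = 2%:R ^+ n by rewrite rmorphXn rmorph_nat.
have al0 : al != 0 by apply: contraNneq q0 => al0; rewrite ed al0 mul0r.
have eal : al^* = u * d.
  by apply: (mulfI q0); rewrite mulrA -eu [in LHS]ed; ring.
have [N eN] := integers_norm oal.
have [v ev] : exists v : int, u = v%:~R.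
  apply/intrP/Cint_rat_Aint; last by case: ou.
  have -> : u = (al * al^*) / 2%:R ^+ n by rewrite eu mulrC mulKf.
  by rewrite rpred_div ?rpredX ?rpred_nat // eN rpred_int.
have [m em] := integers_norm od.
have v0 : 0 < v.
  have : 0 < 2%:R ^+ n * u :> algC by rewrite -eu mul_conjC_gt0.
  by rewrite pmulr_rgt0 ?exprn_gt0 ?ltr0n // ev ltr0z.
have vm : v * m = 2 ^+ n.
  apply: (@intr_inj algC); apply: (mulfI q0); rewrite rmorphM rmorphXn /= -ev -em.
  have -> : 2%:R ^+ n * 2%:R ^+ n = al * al^* * (d * d^*) :> algC.
    by rewrite -{2}qc ed rmorphM /= mulrACA.
  by rewrite eu -mulrA.
suff v1 : v = 1 by rewrite eu ev v1 mulr1.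
have : (`|v| %| 2 ^ n)%N by apply/dvdnP; exists `|m|%N; rewrite -abszM mulrC vm abszX.
case/(dvdn_pfactor _ _ (isT : prime 2)) => -[|i] _ vi; first by lia.
case: al2; exists ((2%:R ^+ i * d)^*).
  by apply: integers_conj; apply: integers_mul => //; apply: integers_exp; exact: (integers_nat p 2).
have vE : v = 2 * 2 ^+ i by rewrite -(gez0_abs (ltW v0)) vi -natz natrX exprS.
have uE : u = 2%:R * 2%:R ^+ i by rewrite ev vE rmorphM rmorphXn.
by rewrite -[LHS]conjCK eal uE -mulrA rmorphM /= rmorph_nat.
Qed.

Lemma principal_root (p m : nat) (I : algC -> Prop) (al be : algC) (e : bool) :
  is_ideal p I -> ring_of_integers p al -> ring_of_integers p be -> be != 0 ->
  be ^+ 2 = (-1) ^+ e * al ->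
  (forall z, ideal_exp p I (m + m) z <-> exists2 w, ring_of_integers p w & z = al * w) ->
  same_ideal_class p (ideal_exp p I m) (ring_of_integers p).
Proof.
move=> idI oal obe be0 be2 alE.
have als : al = (-1) ^+ e * be ^+ 2 by rewrite be2 mulrA -expr2 sqrr_sign mul1r.
have os : ring_of_integers p ((-1) ^+ e).
  by apply: integers_exp; exact: (integers_int p (-1)).
have [IO I0 ID IM] := ideal_exp_ideal m idI.
have sub x : ideal_exp p I m x -> exists2 w, ring_of_integers p w & x = be * w.
  move=> Ix; exists (x / be); last by rewrite mulrC divfK.
  split; first by apply: Qsqrt_div; [case: (IO _ Ix)|case: obe].
  have [w ow ew] := (alE _).1 (ideal_expD idI Ix Ix).
  apply: Aint_sqr; have -> : (x / be) ^+ 2 = (-1) ^+ e * w.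
    rewrite expr_div_n expr2 ew als mulrAC mulfK ?expf_neq0 //.
  by case: (integers_mul os ow).
(* Each product in I^m I^m has its first factor in (be), so al = be w with w in I^m. Comparison with
   be^2 = (-1)^e al gives be = (-1)^e w. *)
have Ibe : ideal_exp p I m be.
  have [w Iw ew] : exists2 w, ideal_exp p I m w & al = be * w.
    apply: (@ideal_expD_ind p m m I (fun z => exists2 w, ideal_exp p I m w & z = be * w)) => //.
    - by exists 0; rewrite ?mulr0.
    - move=> _ _ [w Iw ->] [w' Iw' ->]; exists (w + w'); first exact: ID.
      by rewrite mulrDr.
    - move=> x y /sub[w ow ->] Iy; exists (w * y); first exact: IM.
      by rewrite mulrA.
    - by apply/alE; exists 1; [exact: (integers_nat p 1)|rewrite mulr1].
  have -> : be = (-1) ^+ e * w; last exact: IM.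
  by apply: (mulfI be0); rewrite -expr2 be2 ew mulrCA.
exists 1, be; split=> //; [exact: (integers_nat p 1)|exact: oner_neq0|].
move=> z; split=> [[x /sub[w ow ->] ->]|[w ow ->]].
  by exists w; rewrite ?mul1r.
by exists (be * w); rewrite ?mul1r // mulrC; exact: IM.
Qed.

Lemma prime_above2_order_odd (p : nat) (P : algC -> Prop) (n : nat) :
  prime p -> (p = 7 %[mod 8])%N -> is_prime_ideal p P -> lies_above 2 P ->
  class_order p P n -> odd n.
Proof.
move=> pp p7 Pprime P2 [n0 princ nmin]; have idP : is_ideal p P by case: Pprime.
have p3 : (p = 3 %[mod 4])%N by lia.
have [g [k [og gg cg Pg gen]]] := prime_above2_generator pp p7 Pprime P2.
apply/negPn/negP => en; pose m := n./2; have nm : n = (m + m)%N by lia.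
have [al [oal al0 alE]] := principal_of_same_class (ideal_exp_ideal n idP) princ.
have P2' : P 2%:R by apply/(P2 2).
have [aln al2] := principal_power_norm idP og gg cg Pg P2' gen n0 oal alE.
have [x [y [alxy xy [N [alN xyN]]]]] := integers_half_sum pp p3 oal.
have NE : N = 2 ^+ n.
  by apply: (@intr_inj algC); rewrite -alN aln rmorphXn.
have xyE : x ^+ 2 + p%:Z * y ^+ 2 = 2 ^+ (m.+1).*2.
  by rewrite xyN NE nm doubleS -addnn !exprS; ring.
have [j pj] : exists j : int, p%:Z = 4 * j + 3 by exists (p %/ 4)%N; lia.
have [q nq] : exists q : int, 2 ^+ n = 2 * q.
  by exists (2 ^+ n.-1); rewrite -exprS prednK.
(* If x is even, so is y. The halves satisfy x'^2 + p y'^2 = 2^n, which is even, so they have equal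
   parity and al / 2 is integral, a contradiction. *)
have xodd : ~~ (2 %| x)%Z.
  apply/negP => x2; have /dvdzP[y' ey] : (2 %| y)%Z.
    by have -> : y = x - (x - y) by [ring]; rewrite rpredB.
  have /dvdzP[x' ex] := x2.
  case: al2; exists ((x'%:~R + y'%:~R * sqrtC (- p%:R)) / 2%:R).
    apply: half_sum_integers => //; apply: prime_dvdz_sqr => //.
    have E : x' ^+ 2 + p%:Z * y' ^+ 2 = 2 * q.
      have : 4 * (x' ^+ 2 + p%:Z * y' ^+ 2) = 4 * (2 * q).
        by rewrite -nq -NE -xyN ex ey; ring.
      by lia.
    apply/dvdzP; exists (q - (2 * j + 1) * y' ^+ 2 - x' * y').
    have -> : (x' - y') ^+ 2 = (x' ^+ 2 + p%:Z * y' ^+ 2) - (p%:Z - 1) * y' ^+ 2 - 2 * (x' * y') by ring.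
    by rewrite E pj; ring.
  by rewrite alxy ex ey !rmorphM /=; field.
(* Otherwise x^2 would be a power of 2 with positive exponent and x would be even. *)
have y0 : y != 0.
  apply: contraNneq xodd => y0; apply: prime_dvdz_sqr => //.
  have -> : x ^+ 2 = 2 ^+ (m.+1).*2 by rewrite -xyE y0; ring.
  by rewrite doubleS exprS dvdz_mulr.
have [a [b [e be1 be2]]] := norm_form_square pp xodd xyE y0.
have m0 : (0 < m < n)%N by lia.
apply: (nmin m m0); rewrite nm in alE.
set be : algC := (b%:~R + a%:~R * sqrtC (- p%:R)) / 2%:R.
have sq : be ^+ 2 = (-1) ^+ e * al.
  have b1 : b%:~R ^+ 2 - p%:R * a%:~R ^+ 2 = (-1) ^+ e * (2%:R * x%:~R) :> algC.
    have -> : b%:~R ^+ 2 - p%:R * a%:~R ^+ 2 = (b ^+ 2 - p%:Z * a ^+ 2)%:~R :> algC by ring.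
    by rewrite be1; case: (e); ring.
  have b2 : a%:~R * b%:~R = (-1) ^+ e * y%:~R :> algC.
    by rewrite -rmorphM /= be2; case: (e); ring.
  rewrite alxy /be; have := sqrtC_neg_sqr p; move: (sqrtC _) => s s2.
  have -> : ((b%:~R + a%:~R * s) / 2%:R) ^+ 2 =
     ((b%:~R ^+ 2 - p%:R * a%:~R ^+ 2) + 2%:R * (a%:~R * b%:~R) * s) / 4%:R :> algC.
    by field: s2.
  by rewrite b1 b2; field.
apply: (principal_root idP oal _ _ sq alE).
  apply: half_sum_integers => //; apply: prime_dvdz_sqr => //.
  (* Half of (b - a)^2 = (-1)^e 2x + (p + 1) a^2 - 2ab, with p + 1 = 4j + 4; so a and b have equal
     parity and [be] is integral. *)
  apply/dvdzP; exists ((-1) ^+ e * x + (2 * j + 2) * a ^+ 2 - a * b).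
  have -> : (b - a) ^+ 2 = (b ^+ 2 - p%:Z * a ^+ 2) + (p%:Z + 1) * a ^+ 2 - 2 * (a * b) by ring.
  by rewrite be1 pj; ring.
apply: contraNneq al0 => be0; move/eqP: sq.
by rewrite be0 expr0n eq_sym mulf_eq0 signr_eq0.
Qed.

Theorem proposition25 (p : nat) (hp : prime p)
    (hmod : (p = 71 %[mod 120])%N \/ (p = 119 %[mod 120])%N)
    (P : algC -> Prop) (hP : is_prime_ideal p P) (hP2 : lies_above 2 P)
    (ord : nat) (hord : class_order p P ord)
    (v : 'I_ord) (hv : ~~ (2 %| v)%N) :
  ((ecc (folded_component ord) v)%:R : rat) =
    if (ord%:R - 1) / 2%:R <= (v%:R : rat)
    then (v%:R + 1) / 2%:R
    else (ord%:R - v%:R) / 2%:R.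
Proof.
(* 8 divides 120, and both 71 and 119 are 7 mod 8. *)
have pp8 : (p = 7 %[mod 8])%N by lia.
apply: folded_ecc_rat; last by rewrite dvdn2 negbK in hv.
exact: prime_above2_order_odd hP hP2 hord.
Qed.
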